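(* There exist a separable Banach function space $X$ on the unit circle $\mathbb{T}$ and a function $f\in X$ such that the relation $$\lim_{n\to\infty}\|f*F_n-f\|_X=0$$ is not fulfilled, where $F_n$ is the $n$-th Fejér kernel.
   Context: $\mathbb{T}=\{z\in\mathbb{C}:|z|=1\}$ is the unit circle with normalized Lebesgue measure $dm(t)=|dt|/(2\pi)$; $L^1=L^1(\mathbb{T})$. $L^0$ is the space of measurable complex-valued functions on $\mathbb{T}$ (functions equal a.e. are identified), and $L^0_+$ is the set of measurable functions on $\mathbb{T}$ with values in $[0,\infty]$. Banach function space: a mapping $\rho:L^0_+\to[0,\infty]$ is a Banach function norm if for all $f,g,f_n\in L^0_+$ ($n\in\mathbb{N}$), all constants $a\ge 0$ and all measurable $E\subset\mathbb{T}$: (A1) $\rho(f)=0\Leftrightarrow f=0$ a.e., $\rho(af)=a\rho(f)$, $\rho(f+g)\le\rho(f)+\rho(g)$; (A2) $0\le g\le f$ a.e. implies $\rho(g)\le\rho(f)$; (A3) $0\le f_n\uparrow f$ a.e. implies $\rho(f_n)\uparrow\rho(f)$; (A4) $m(E)<\infty$ implies $\rho(\chi_E)<\infty$; (A5) $\int_E f\,dm\le C_E\,\rho(f)$ with a constant $C_E\in(0,\infty)$ that may depend on $E$ and $\rho$ but not on $f$. The set $X=\{f\in L^0:\rho(|f|)<\infty\}$ with norm $\|f\|_X=\rho(|f|)$ is called a Banach function space; it is continuously embedded in $L^1$. ''Separable'' means separable as a normed space. Convolution: $(f*g)(e^{i\theta})=\frac{1}{2\pi}\int_{-\pi}^{\pi}f(e^{i\theta-i\varphi})g(e^{i\varphi})\,d\varphi$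 for $f,g\in L^1$. Fejér kernel: for $n\in\mathbb{N}$, $$F_n(e^{i\theta})=\sum_{k=-n}^n\left(1-\frac{|k|}{n+1}\right)e^{i\theta k}.$$ *)

(* Defs.v *)
From HB Require Import structures.
From mathcomp Require Import all_boot all_order all_algebra.
From mathcomp Require Import all_classical all_reals all_analysis.
From mathcomp Require Import measurable_realfun complex.
Set Implicit Arguments.
Unset Strict Implicit.
Unset Printing Implicit Defensive.
Import Order.TTheory GRing.Theory Num.Theory numFieldNormedType.Exports.
Local Open Scope classical_set_scope.
Local Open Scope ring_scope.

Definition circle (R : realType) : Type := {z : R[i] | `|z| == 1}.

Section circle_structure.
Context {R : realType}.
Implicit Types z w : circle R.

HB.instance Definition _ := Choice.on (circle R).

Lemma expi_subproof (t : R) : `|(cos t +i* sin t)%C| == 1.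
Proof. by rewrite normc_def /= cos2Dsin2 sqrtr1. Qed.

Definition expi (t : R) : circle R :=
  exist (fun u : R[i] => `|u| == 1) _ (expi_subproof t).

HB.instance Definition _ := isPointed.Build (circle R) (expi 0).

Lemma circle_mul_subproof z w : `|sval z * sval w| == 1.
Proof. by rewrite normrM (eqP (svalP z)) (eqP (svalP w)) mulr1. Qed.

Definition circle_mul z w : circle R :=
  exist (fun u : R[i] => `|u| == 1) _ (circle_mul_subproof z w).

Definition circle_display : measure_display. Proof. exact. Qed.

(* The map expi : R -> T is a quotient map that is a homeomorphism on short
   arcs, so E is a Borel subset of T iff its preimage under expi is a Borel
   subset of R; this is how the Borel sets of T are defined here. *)
Definition circle_measurable : set (set (circle R)) :=
  image_set_system [set: R] expi measurable.

Let circle_measurable0 : circle_measurable set0.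
Proof.
by rewrite /circle_measurable /image_set_system /= preimage_set0 setI0.
Qed.

Let circle_measurableC A : circle_measurable A -> circle_measurable (~` A).
Proof.
rewrite /circle_measurable /image_set_system /= !setTI preimage_setC.
exact: measurableC.
Qed.

Let circle_measurable_bigcup (F : (set (circle R))^nat) :
  (forall i, circle_measurable (F i)) -> circle_measurable (\bigcup_i F i).
Proof.
rewrite /circle_measurable /image_set_system /= => mF.
rewrite setTI preimage_bigcup.
by apply: bigcup_measurable => i _; rewrite -[X in measurable X]setTI.
Qed.

HB.instance Definition _ := isMeasurable.Build circle_display (circle R)
  circle_measurable0 circle_measurableC circle_measurable_bigcup.

Lemma measurable_expi : measurable_fun [set: R] expi.
Proof. by move=> _ A. Qed.

Lemma invr_2pi_ge0 : 0 <= (2 * pi)^-1 :> R.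
Proof. by rewrite invr_ge0 mulr_ge0 ?pi_ge0. Qed.

(* m(E) = |{t in [-pi, pi] : e^{it} in E}| / (2 pi) *)
Definition circle_measure : set (circle R) -> \bar R :=
  pushforward
    (mscale (NngNum invr_2pi_ge0)
      (mrestr lebesgue_measure (measurable_itv `[(- pi)%R : R, pi])))
    expi.

HB.instance Definition _ :=
  Measure.copy circle_measure
    (measure_function_pushforward__canonical__measure_function_Measure
       (mscale (NngNum invr_2pi_ge0)
         (mrestr lebesgue_measure (measurable_itv `[(- pi)%R : R, pi])))
       measurable_expi).

End circle_structure.

Section complex_functions.
Context {R : realType}.

Definition cmeasurable d (T : measurableType d) (f : T -> R[i]) : Prop :=
  measurable_fun [set: T] (fun x => complex.Re (f x)) /\
  measurable_fun [set: T] (fun x => complex.Im (f x)).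

Definition cintegral d (T : measurableType d) (mu : {measure set T -> \bar R})
    (D : set T) (f : T -> R[i]) : R[i] :=
  ((\int[mu]_(x in D) complex.Re (f x)) +i*
   (\int[mu]_(x in D) complex.Im (f x)))%C.

Definition emod (T : Type) (f : T -> R[i]) : T -> \bar R :=
  fun x => (Normc.normc (f x))%:E.

(* With z = e^{i theta}, circle_mul z (expi (- phi)) is e^{i(theta - phi)}. *)
Definition convolution (f g : circle R -> R[i]) : circle R -> R[i] :=
  fun z => ((2 * pi)^-1)%:C%C *
    cintegral lebesgue_measure `[(- pi)%R : R, pi]
      (fun phi => f (circle_mul z (expi (- phi))) * g (expi phi)).

(* The index j = 0, ..., 2n stands for the frequency k = j - n. *)
Definition fejer (n : nat) : circle R -> R[i] :=
  fun z => \sum_(j < n.*2.+1)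
    let k : int := j%:Z - n%:Z in
    (1 - `|k|%:~R / n.+1%:R) * sval z ^ k.

End complex_functions.

Section banach_function_space.
Context {R : realType}.
Local Open Scope ereal_scope.
Implicit Types f g : circle R -> \bar R.

Definition L0plus : set (circle R -> \bar R) :=
  [set f : circle R -> \bar R | measurable_fun [set: circle R] f
    /\ forall z, 0 <= f z].

(* Only the values of rho on L0plus are constrained. *)
Record banach_function_norm (rho : (circle R -> \bar R) -> \bar R) : Prop := {
  bfn_ge0 : forall f, L0plus f -> 0 <= rho f ;
  bfn_eq0 : forall f, L0plus f ->
    rho f = 0 <-> {ae circle_measure, forall z, f z = 0} ;
  bfn_scale : forall (a : R) f, (0 <= a)%R -> L0plus f ->
    rho (fun z => a%:E * f z) = a%:E * rho f ;
  bfn_triangle : forall f g, L0plus f -> L0plus g ->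
    rho (f \+ g) <= rho f + rho g ;
  bfn_mono : forall f g, L0plus f -> L0plus g ->
    {ae circle_measure, forall z, g z <= f z} -> rho g <= rho f ;
  bfn_fatou : forall (f_ : (circle R -> \bar R)^nat) f,
    (forall n, L0plus (f_ n)) -> L0plus f ->
    {ae circle_measure, forall z, nondecreasing_seq (f_ ^~ z) /\
                                  f_ ^~ z @ \oo --> f z} ->
    nondecreasing_seq (rho \o f_) /\ rho \o f_ @ \oo --> rho f ;
  bfn_indic : forall E : set (circle R), measurable E ->
    circle_measure E < +oo -> rho (fun z => (\1_E z)%:E) < +oo ;
  bfn_integral : forall E : set (circle R), measurable E ->
    exists2 C : R, (0 < C)%R &
      forall f, L0plus f -> \int[circle_measure]_(z in E) f z <= C%:E * rho f
}.

(* Elements of X are represented by functions, so bfs_norm rho is a norm on X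
   once functions that agree a.e. are identified. *)
Definition bfs (rho : (circle R -> \bar R) -> \bar R) :
    set (circle R -> R[i]) :=
  [set f | cmeasurable f /\ rho (emod f) < +oo].

Definition bfs_norm (rho : (circle R -> \bar R) -> \bar R)
    (f : circle R -> R[i]) : \bar R := rho (emod f).

Definition bfs_separable (rho : (circle R -> \bar R) -> \bar R) : Prop :=
  exists D : set (circle R -> R[i]),
    [/\ countable D, D `<=` bfs rho &
        forall (f : circle R -> R[i]) (e : R), bfs rho f -> (0 < e)%R ->
          exists2 g, D g & bfs_norm rho (fun z => f z - g z)%R < e%:E].

End banach_function_space.

(* Main.v *)
Require Import Defs.
From mathcomp Require Import all_boot all_order all_algebra.
From mathcomp Require Import all_classical all_reals all_analysis.
From mathcomp Require Import measurable_realfun complex.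
From mathcomp Require Import ring lra zify.
Import Order.TTheory GRing.Theory Num.Theory numFieldNormedType.Exports.
Local Open Scope classical_set_scope.
Local Open Scope ring_scope.

(** The space is a weighted [L^1]. Write [h t = t^(-1/2)] for [0 < t < 1] and
    [h t = 0] elsewhere ([rsing]), and let [rho f] be the integral of [f w],
    where [w (e^(i t)) = 1 + h t] for [t] in [-pi, pi[ ([weight], [wnorm]). Since
    [w] is integrable and at least [1], [rho] is a Banach function norm
    ([wnorm_banach]); multiplication by [w] is an isometry onto the unweighted
    [L^1], so the space is separable ([bfs_separable_wnorm]).

    The norm is not translation invariant: moving mass from small negative to
    small positive arguments can increase it without bound. The function
    [f (e^(i t)) = h (- t)] ([fsing]) belongs to the space, because it lives
    where [w = 1]. Let [d = 1/(2n)]. The Fejer kernel, being the square of the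
    modulus of a geometric sum divided by [n + 1] ([fejer_expi]), is nonnegative,
    and it is at least [(n + 1) (cos 1)^2] at distance at most [1/n] from the
    origin ([fejer_re_ge]). As [f] is at least [d^(-1/2)] on ]-d, 0[, the
    convolution of [f] with the kernel is at least a constant times [d^(-1/2)]
    on ]0, d[, where [f] vanishes and [w] is at least [d^(-1/2)] too
    ([Re_convolution_fsing_ge]). The distance from [f] to its [n]-th Fejer mean
    is thus at least a constant times [d^(-1/2) d^(-1/2) d = 1], and does not tend
    to [0] ([bfs_norm_fejer_fsing_ge]). *)

(** * The Fejer kernel as a square *)

Section fejer_kernel.

(** The geometric sum is reversed by multiplication by its last inverse power. *)
Lemma sum_exprM_exprV (F : fieldType) (z : F) (n : nat) : z != 0 ->
  (\sum_(a < n.+1) z ^+ a) * z^-1 ^+ n = \sum_(a < n.+1) z^-1 ^+ a.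
Proof.
move=> z0; elim: n => [|n IH]; first by rewrite !big_ord1 mulr1.
rewrite big_ord_recr/= mulrDl -exprMn mulfV// expr1n [RHS]big_ord_recl expr0.
rewrite exprS mulrCA IH mulr_sumr addrC; congr (_ + _).
by apply: eq_bigr => i _; rewrite lift0 exprS.
Qed.

Lemma sum_exprS (F : fieldType) (z : F) (n : nat) :
  \sum_(a < n.+2) z ^+ a = 1 + z * \sum_(a < n.+1) z ^+ a.
Proof.
rewrite big_ord_recl expr0 mulr_sumr; congr (_ + _).
by apply: eq_bigr => i _; rewrite lift0 exprS.
Qed.

Lemma dirichlet_sum (F : fieldType) (z : F) (n : nat) : z != 0 ->
  \sum_(j < n.*2.+1) z ^ (j%:Z - n%:Z) =
  \sum_(a < n.+1) z ^+ a + \sum_(a < n.+1) z^-1 ^+ a - 1.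
Proof.
move=> z0; elim: n => [|n IH].
  by rewrite !big_ord1 subrr expr0z !expr0 addrK.
rewrite doubleS big_ord_recl big_ord_recr/=.
rewrite (eq_bigr (fun j : 'I_(n.*2.+1) => z ^ (j%:Z - n%:Z))); last first.
  by move=> i _; congr (_ ^ _); rewrite /bump/=; lia.
rewrite IH ![\sum_(a < n.+2) _]big_ord_recr/=.
rewrite /bump/= (_ : Posz 0 - n.+1%:Z = - n.+1%:Z)//; last by rewrite sub0r.
rewrite (_ : _ - n.+1%:Z = n.+1%:Z); last by lia.
rewrite -exprnN -exprnP -exprVn; ring.
Qed.

(** The Fejer identity [F_n = |1 + z + ... + z^n|^2 / (n + 1)], cleared of its
    denominator and with [z^-1] in place of the conjugate of [z]. *)
Lemma fejer_sum (F : fieldType) (z : F) (n : nat) : z != 0 ->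
  \sum_(j < n.*2.+1) (n.+1%:R - `|j%:Z - n%:Z|%:~R) * z ^ (j%:Z - n%:Z) =
  (\sum_(a < n.+1) z ^+ a) * (\sum_(a < n.+1) z^-1 ^+ a).
Proof.
move=> z0; elim: n => [|n IH].
  by rewrite !big_ord1 !expr0 subrr expr0z normr0 subr0 mulr1.
rewrite doubleS big_ord_recl big_ord_recr/=.
rewrite (eq_bigr (fun j : 'I_(n.*2.+1) =>
   (n.+1%:R - `|j%:Z - n%:Z|%:~R) * z ^ (j%:Z - n%:Z) + z ^ (j%:Z - n%:Z))); last first.
  move=> i _; rewrite (_ : (bump 0 i)%:Z - _ = i%:Z - n%:Z); last first.
    by rewrite /bump/=; lia.
  by rewrite -[n.+2%:R]natr1; ring.
rewrite big_split/= IH dirichlet_sum//.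
rewrite /bump/= (_ : Posz 0 - n.+1%:Z = - n.+1%:Z)//; last by rewrite sub0r.
rewrite (_ : _ - n.+1%:Z = n.+1%:Z); last by lia.
rewrite normrN (_ : `|n.+1%:Z|%:~R = n.+1%:R)//.
rewrite -[n.+2%:R]natr1 [n.+1%:R + 1]addrC addrK !mul1r.
rewrite -exprnN -exprnP -exprVn.
rewrite ![\sum_(a < n.+2) _]big_ord_recr/=.
have zV0 : z^-1 != 0 by rewrite invr_eq0.
have H1 := sum_exprM_exprV F z n z0.
have H2 := sum_exprM_exprV F _ n zV0; rewrite invrK in H2.
have H3 := sum_exprS F z n; have H4 := sum_exprS F z^-1 n.
rewrite big_ord_recr/= in H3; rewrite big_ord_recr/= in H4.
have H5 : z ^+ n.+1 * z^-1 ^+ n.+1 = 1 by rewrite -exprMn mulfV// expr1n.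
move: H1 H2 H3 H4 H5; set A := \sum_(i < n.+1) z ^+ i.
set B := \sum_(i < n.+1) z^-1 ^+ i => H1 H2 H3 H4 H5.
rewrite mulrDl !mulrDr H5.
have -> : A * z^-1 ^+ n.+1 = B + z^-1 ^+ n.+1 - 1.
  by rewrite H4 exprS mulrCA H1; ring.
have -> : z ^+ n.+1 * B = A + z ^+ n.+1 - 1.
  by rewrite H3 mulrC exprS mulrCA H2; ring.
ring.
Qed.

End fejer_kernel.

(** * Bounds for the Fejer kernel on the circle *)

Section fejer_on_circle.
Context {R : realType}.

Lemma circle_mulE (a b : R) : circle_mul (expi a) (expi b) = expi (a + b).
Proof.
apply: val_inj; rewrite /= cosD sinD.
by apply/eqP; rewrite eq_complex/= eqxx/= addrC eqxx.
Qed.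

Lemma expi_neq0 (t : R) : sval (expi t) != 0 :> R[i].
Proof.
by apply/eqP => h; have := svalP (expi t); rewrite h normr0 eq_sym oner_eq0.
Qed.

Lemma expi_exprn (t : R) n :
  (sval (expi t) : R[i]) ^+ n = (cos (n%:R * t) +i* sin (n%:R * t))%C.
Proof.
elim: n => [|n IH]; first by rewrite mul0r cos0 sin0.
rewrite exprS IH -natr1 mulrDl mul1r addrC cosD sinD/=.
by apply/eqP; rewrite eq_complex/= eqxx/= addrC eqxx.
Qed.

Lemma expi_inv (t : R) : (sval (expi t) : R[i])^-1 = sval (expi (- t)).
Proof.
apply: (mulfI (expi_neq0 t)); rewrite mulfV ?expi_neq0//.
by have := congr1 sval (circle_mulE t (- t)); rewrite subrr/= cos0 sin0 => ->.
Qed.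

Let csum (n : nat) (t : R) : R := \sum_(a < n.+1) cos (a%:R * t).
Let ssum (n : nat) (t : R) : R := \sum_(a < n.+1) sin (a%:R * t).

Lemma sum_expi n (t : R) :
  \sum_(a < n.+1) (sval (expi t) : R[i]) ^+ a = (csum n t +i* ssum n t)%C.
Proof.
rewrite /csum /ssum; elim: n => [|n IH].
  by rewrite !big_ord1 expi_exprn.
rewrite big_ord_recr/= IH !(big_ord_recr n.+1)/= expi_exprn.
by apply/eqP; rewrite eq_complex/= !eqxx.
Qed.

(** On the circle the Fejer kernel is the square of the modulus of
    [1 + z + ... + z^n], divided by [n + 1]. *)
Lemma fejer_expi n (t : R) : fejer n (expi t) =
  ((((\sum_(a < n.+1) cos (a%:R * t)) ^+ 2 +
     (\sum_(a < n.+1) sin (a%:R * t)) ^+ 2) / n.+1%:R)%:C)%C.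
Proof.
have n0 : n.+1%:R != 0 :> R[i] by rewrite pnatr_eq0.
apply: (mulfI n0); rewrite /fejer mulr_sumr.
under eq_bigr do rewrite mulrA mulrBr mulr1 mulrCA mulfV// mulr1.
rewrite fejer_sum ?expi_neq0// expi_inv !sum_expi -/(csum n t) -/(ssum n t).
have -> : csum n (- t) = csum n t.
  by apply: eq_bigr => i _; rewrite mulrN cosN.
have -> : ssum n (- t) = - ssum n t.
  by rewrite /ssum -sumrN; apply: eq_bigr => i _; rewrite mulrN sinN.
rewrite rmorphM/= fmorphV rmorph_nat mulrCA mulfV// mulr1.
by apply/eqP; rewrite eq_complex/= !expr2; apply/andP; split; apply/eqP; ring.
Qed.

(** The Fejer kernel, which is real, as a function of the argument. *)
Definition fejer_re n (t : R) : R := complex.Re (fejer n (expi t)).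

Lemma fejer_reE n t : fejer_re n t =
  ((\sum_(a < n.+1) cos (a%:R * t)) ^+ 2 +
     (\sum_(a < n.+1) sin (a%:R * t)) ^+ 2) / n.+1%:R.
Proof. by rewrite /fejer_re fejer_expi. Qed.

Lemma fejer_re_ge0 n t : 0 <= fejer_re n t.
Proof. by rewrite fejer_reE divr_ge0// addr_ge0 ?sqr_ge0. Qed.

Lemma fejer_re_le n t : fejer_re n t <= 2 * n.+1%:R.
Proof.
have bnd (f : R -> R) : (forall x, `|f x| <= 1) ->
    (\sum_(a < n.+1) f (a%:R * t)) ^+ 2 <= n.+1%:R ^+ 2.
  move=> f1; rewrite -ler_sqrt ?sqr_ge0 ?exprn_gt0// !sqrtr_sqr normr_nat.
  apply: le_trans (ler_norm_sum _ _ _) _.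
  by apply: le_trans (ler_sum _ (fun i _ => f1 _)) _; rewrite sumr_const card_ord.
rewrite fejer_reE ler_pdivrMr// -mulrA -expr2 mulrDl mul1r.
by rewrite lerD ?bnd// => x; [exact: cos_max|exact: sin_max].
Qed.

Lemma measurable_fejer_re n : measurable_fun [set: R] (fejer_re n).
Proof.
rewrite (_ : fejer_re n = fun t => (csum n t ^+ 2 + ssum n t ^+ 2) * n.+1%:R^-1); last first.
  by apply/funext => t; rewrite fejer_reE.
apply: measurable_funM => //.
apply: measurable_funD; apply: measurable_funX; apply: measurable_sum => i;
  apply: measurableT_comp; try exact: measurable_funM.
- by apply: continuous_measurable_fun; exact: continuous_cos.
- by apply: continuous_measurable_fun; exact: continuous_sin.
Qed.

(** Near the origin no cosine in the sum is below [cos 1]. *)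
Lemma fejer_re_ge n t : n%:R * `|t| <= 1 -> n.+1%:R * cos 1 ^+ 2 <= fejer_re n t.
Proof.
move=> nt; have cos_ge (a : 'I_n.+1) : cos 1 <= cos (a%:R * t).
  have at1 : `|a%:R * t| <= 1.
    rewrite normrM normr_nat (le_trans _ nt)// ler_wpM2r//.
    by rewrite ler_nat -ltnS.
  have pi1 : (1 : R) <= pi by rewrite (le_trans _ (pi_ge2 R))// ler1n.
  rewrite -(@cos_norm _ (_ * t)) leNgt; apply/negP.
  rewrite ltr_cos ?in_itv/= ?ler01 ?normr_ge0 ?(le_trans at1)//.
  by rewrite ltNge at1.
rewrite fejer_reE ler_pdivlMr// -[leLHS]addr0 lerD ?sqr_ge0//.
rewrite mulrAC -expr2 -exprMn.
have sum_ge : n.+1%:R * cos 1 <= \sum_(a < n.+1) cos (a%:R * t).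
  rewrite (_ : n.+1%:R * _ = \sum_(a < n.+1) cos 1 :> R) ?ler_sum//.
  by rewrite sumr_const card_ord mulr_natl.
have c0 : 0 <= n.+1%:R * cos 1 :> R by rewrite mulr_ge0// ltW// cos1_gt0.
by rewrite ler_pXn2r// nnegrE// (le_trans c0).
Qed.

End fejer_on_circle.

(** * Argument and integration on the circle *)

Section argument.
Context {R : realType}.

Lemma expi_inj (a b : R) : - pi <= a < pi -> - pi <= b < pi ->
  expi a = expi b -> a = b.
Proof.
wlog ba : a b / b <= a => [H|] ha hb e.
  by have [ab|ab] := leP b a; [exact: H|apply/esym/H => //; exact: ltW].
have /eqP := congr1 sval e; rewrite eq_complex/= => /andP[/eqP ec /eqP es].
apply/eqP; rewrite eq_le ba andbT leNgt; apply/negP => lt_ba.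
have : cos (((a - b) / 2) *+ 2) = 1.
  by rewrite -mulr_natr divfK// cosB ec es -!expr2 cos2Dsin2.
rewrite cos_mulr2n cos2sin2 => h.
have : 0 < sin ((a - b) / 2) by apply: sin_gt0_pi; lra.
by move=> s0; have : 0 < sin ((a - b) / 2) ^+ 2 by [rewrite exprn_gt0|]; lra.
Qed.

Lemma expi_periodic (t : R) (m : int) : expi (t + m%:~R * (2 * pi)) = expi t.
Proof.
have nat_per (s : R) (k : nat) : expi (s + k%:R * (2 * pi)) = expi s.
  apply: val_inj; rewrite /= mulrCA !mulr_natl -mulrnA mulnC mulrnA.
  by rewrite (periodicn (@cosD2pi R)) (periodicn (@sinD2pi R)).
case: m => k; first exact: nat_per.
rewrite NegzE -(nat_per (t + _) k.+1); congr expi.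
by rewrite mulrNz; ring.
Qed.

(** The argument of a point of the circle, in [-pi, pi[. With the default value
    [0], a nonzero argument certifies that the point is some [expi t], so that
    the surjectivity of [expi] is not needed. *)
Definition carg (z : circle R) : R :=
  xget 0 [set t | - pi <= t < pi /\ expi t = z].

Lemma carg_expi (t : R) : - pi <= t < pi -> carg (expi t) = t.
Proof.
move=> tpi; rewrite /carg; case: xgetP => [s _ [spi]|/(_ t)]; last by case.
exact: expi_inj.
Qed.

Lemma expi_carg (z : circle R) : carg z != 0 -> expi (carg z) = z.
Proof.
by rewrite /carg; case: xgetP => [s _ [_ ->]//|_]; rewrite eqxx.
Qed.

Lemma carg_expiE (t : R) :
  carg (expi t) = t - (Num.floor ((t + pi) / (2 * pi)))%:~R * (2 * pi).
Proof.
set m := Num.floor _; rewrite -(expi_periodic t (- m)) carg_expi.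
  by rewrite mulrNz mulNr.
have p0 := @pi_gt0 R.
have p2 : 0 < 2 * pi :> R by rewrite mulr_gt0.
have := real_floor_itv (num_real ((t + pi) / (2 * pi))).
rewrite -/m ler_pdivlMr// ltr_pdivrMr// intrD (mulrDl m%:~R) mul1r mulrNz mulNr.
by move: (m%:~R * _) => x; lra.
Qed.

Lemma measurable_carg : measurable_fun [set: circle R] carg.
Proof.
move=> _ A mA; rewrite setTI /measurable/= /circle_measurable /image_set_system/=.
rewrite setTI -comp_preimage -[X in measurable X]setTI.
have : measurable_fun [set: R] (fun t : R =>
    t - (Num.floor ((t + pi) / (2 * pi)))%:~R * (2 * pi)).
  apply: measurable_funB => //; apply: measurable_funM => //.
  apply: nondecreasing_measurable => // s t st.
  rewrite ler_int le_floor// ler_pM2r ?invr_gt0 ?mulr_gt0 ?pi_gt0//.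
  by rewrite lerD2r.
rewrite (_ : (fun t : R => _) = carg \o expi); last first.
  by apply/funext => t; rewrite /= carg_expiE.
by apply.
Qed.

End argument.

Section integral_on_circle.
Context {R : realType}.
Local Open Scope ereal_scope.
Local Notation leb := (@lebesgue_measure R).

Lemma ge0_integral_mrestr d (T : measurableType d)
    (mu : {measure set T -> \bar R}) (D : set T) (mD : measurable D)
    (f : T -> \bar R) :
  measurable_fun setT f -> (forall x, 0 <= f x) ->
  \int[mrestr mu mD]_x f x = \int[mu]_(x in D) f x.
Proof.
move=> mf f0.
have mDC : measurable (~` D) by exact: measurableC.
have nD : mrestr mu mD (~` D) = 0 by rewrite /mrestr setICl measure0.
rewrite [LHS](ge0_negligible_integral mDC)// setTD setCK.
by apply: eq_measure_integral => A mA AD; rewrite /= /mrestr setIidl.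
Qed.

Lemma ge0_integral_circle (f : circle R -> \bar R) :
  measurable_fun setT f -> (forall z, 0 <= f z) ->
  \int[circle_measure]_z f z =
  ((2 * pi)^-1)%:E * \int[leb]_(t in `[(- pi)%R, pi[) f (expi t).
Proof.
move=> mf f0; rewrite /circle_measure.
have mfe : measurable_fun setT (f \o expi).
  exact: measurableT_comp.
rewrite ge0_integral_pushforward//.
rewrite preimage_setT ge0_integral_mscale//.
rewrite ge0_integral_mrestr; [|exact: mfe|by move=> t; exact: f0].
rewrite -integral_itv_bndo_bndc//; exact: measurable_funTS.
by move=> t _; exact: f0.
Qed.

(** Monotonicity of the integral of nonnegative functions that need not be
    measurable. *)
Lemma ge0_le_integral_nonmeasurable d (T : measurableType d)
    (mu : {measure set T -> \bar R}) (D : set T) (f g : T -> \bar R) :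
  (forall x, D x -> 0 <= f x) -> (forall x, D x -> f x <= g x) ->
  \int[mu]_(x in D) f x <= \int[mu]_(x in D) g x.
Proof.
move=> f0 fg; rewrite !ge0_integralE//; last first.
  by move=> x Dx; exact: le_trans (f0 _ Dx) (fg _ Dx).
apply: ereal_sup_le => _ [h hf <-]; exists h => // x.
by apply: le_trans (hf x) _; exact: lee_restrict.
Qed.

End integral_on_circle.

(** * An integrable one-sided singularity *)

Section singularity.
Context {R : realType}.
Local Notation leb := (@lebesgue_measure R).

(** An integrable function that behaves like [t^(-1/2)] to the right of the
    origin and vanishes to its left. *)
Definition rsing : R -> R := (fun t : R => (Num.sqrt t)^-1) \_ `]0, 1[.

Lemma rsing_in t : 0 < t < 1 -> rsing t = (Num.sqrt t)^-1.
Proof. by move=> t01; rewrite /rsing patchE mem_set//= in_itv. Qed.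

Lemma rsing_out t : ~~ (0 < t < 1) -> rsing t = 0.
Proof.
move=> t01; rewrite /rsing patchE memNset//= in_itv/=.
exact/negP.
Qed.

Lemma rsing_ge0 t : 0 <= rsing t.
Proof.
have [/rsing_in ->|/rsing_out ->//] := boolP (0 < t < 1).
by rewrite invr_ge0 sqrtr_ge0.
Qed.

Lemma rsing_ge d t : d <= 1 -> 0 < t < d -> (Num.sqrt d)^-1 <= rsing t.
Proof.
move=> d1 /andP[t0 td]; rewrite rsing_in; last by rewrite t0 (lt_le_trans td).
by rewrite lef_pV2 ?posrE ?sqrtr_gt0 ?(lt_trans t0 td)// ler_wsqrtr// ltW.
Qed.

Lemma measurable_rsing : measurable_fun [set: R] rsing.
Proof.
apply/(measurable_restrictT _ _).1 => //.
apply: open_continuous_measurable_fun; first exact: interval_open.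
move=> t; rewrite inE/= in_itv/= => /andP[t0 _].
by apply: cvgV; [rewrite sqrtr_eq0 -ltNge|exact: sqrt_continuous].
Qed.

Lemma pow4_exists (t : R) : 0 < t < 1 ->
  exists k, t < (4^-1) ^+ k /\ (4^-1) ^+ k.+1 <= t.
Proof.
move=> /andP[t0 t1].
have ex : exists k, (4^-1 : R) ^+ k <= t.
  have [k kt] : exists k, (t^-1 < k%:R).
    by exists (Num.bound t^-1); rewrite archi_boundP// invr_ge0 ltW.
  exists k; rewrite exprVn -[leRHS]invrK lef_pV2 ?posrE ?exprn_gt0 ?invr_gt0//.
  rewrite (le_trans (ltW kt))// -natrX ler_nat ltnW// ltn_expl//.
(* the least exponent is positive since [t < 1]; its predecessor works *)
case: (ex_minnP ex) => -[|k] hk kmin.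
  by move: t1; rewrite ltNge hk.
exists k; split => //; rewrite ltNge; apply/negP => /kmin.
by rewrite ltnn.
Qed.

(** On [4^-(k+1), 4^-k[ the singularity is at most [2^(k+1)], which is the [k]-th
    term of the series. *)
Lemma rsing_le_series t : ((rsing t)%:E <=
  \sum_(0 <= k <oo) (2 ^+ k.+1 * \1_(`]0%R, ((4^-1) ^+ k)%R[%classic) t)%:E)%E.
Proof.
have term0 k : (0 <= (2 ^+ k.+1 * \1_(`]0%R, ((4^-1) ^+ k)%R[%classic) t)%:E :> \bar R)%E.
  by rewrite lee_fin mulr_ge0// exprn_ge0.
have [t01|/rsing_out ->] := boolP (0 < t < 1); last exact: nneseries_ge0.
have [k [tk kt]] := pow4_exists t t01.
apply: le_trans (nneseries_lim_ge k.+1 _); last by move=> *; exact: term0.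
rewrite big_nat_recr//= -[leLHS]add0e leeD ?sume_ge0//.
have -> : \1_(`]0%R, ((4^-1) ^+ k)%R[%classic) t = 1 :> R.
  by rewrite indicE mem_set//= in_itv/= tk andbT; case/andP: t01.
rewrite mulr1 lee_fin rsing_in// -[leRHS]invrK lef_pV2 ?posrE ?sqrtr_gt0 ?invr_gt0
  ?exprn_gt0//; last by case/andP: t01.
rewrite -(@ler_pXn2r _ 2)// ?nnegrE ?sqrtr_ge0 ?invr_ge0 ?exprn_ge0//.
rewrite sqr_sqrtr; last by case/andP: t01 => /ltW.
by rewrite -exprVn -exprM mulnC exprM (_ : 2^-1 ^+ 2 = 4^-1)//; field.
Qed.

(** Integration of the dominating series term by term gives the sum of
    [2^(k+1) 4^-k]. The hypothesis on [phi] covers reflections and translates. *)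
Lemma integral_rsing_comp (phi : R -> R) : measurable_fun [set: R] phi ->
  (forall d, 0 < d -> leb (phi @^-1` `]0, d[) = d%:E) ->
  (\int[leb]_t (rsing (phi t))%:E < +oo)%E.
Proof.
move=> mphi len.
pose I (k : nat) : set R := phi @^-1` `]0%R, (4^-1 ^+ k)%R[.
pose u k (t : R) : \bar R := (2 ^+ k.+1 * \1_(I k) t)%:E.
have mI k : measurable (I k) by rewrite -[I k]setTI; exact: mphi.
have mindic k : measurable_fun [set: R] (fun t => (\1_(I k) t)%:E : \bar R).
  by apply/measurable_EFinP; exact: measurable_indic.
have mu k : measurable_fun [set: R] (u k).
  by apply/measurable_EFinP; apply: measurable_funM => //; exact: measurable_indic.
have u0 k t : (0 <= u k t)%E by rewrite lee_fin mulr_ge0// exprn_ge0.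
have intu k : (\int[leb]_t u k t = (4 / (2 ^ (k + 0.+1))%:R)%:E)%E.
  rewrite /u; under eq_integral do rewrite EFinM.
  rewrite ge0_integralZl//; last exact: mindic.
  rewrite integral_indic//; last exact: mI.
  rewrite setIT [X in (_ * X)%E](len _ _) ?exprn_gt0// -EFinM; congr _%:E.
  have -> : 4^-1 ^+ k = (2 ^+ k)^-1 * (2 ^+ k)^-1 :> R.
    by rewrite -!exprVn -exprMn; congr (_ ^+ _); field.
  rewrite natrX addn1 !exprS; field.
  by rewrite expf_neq0.
apply: (@le_lt_trans _ _ (\int[leb]_t (\sum_(0 <= k <oo) u k t)))%E.
  apply: ge0_le_integral_nonmeasurable => t _; first by rewrite lee_fin rsing_ge0.
  exact: rsing_le_series.
rewrite integral_nneseries// (eq_eseriesr (fun k _ => intu k)).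
have := @cvg_geometric_eseries_half R 4 0; rewrite /eseries => /cvg_lim -> //.
exact: ltry.
Qed.

Lemma integral_rsing_shift (a : R) : (\int[leb]_t (rsing (t - a))%:E < +oo)%E.
Proof.
apply: (@integral_rsing_comp (fun t => t - a)); first exact: measurable_funB.
move=> d d0; rewrite (_ : _ @^-1` _ = `]a, (a + d)%R[%classic).
  by rewrite lebesgue_measure_itv/= lte_fin ltrDl d0 -EFinB addrAC subrr add0r.
by apply/seteqP; split => t /=; rewrite !in_itv/= => ?; lra.
Qed.

Lemma integral_rsing : (\int[leb]_t (rsing t)%:E < +oo)%E.
Proof.
by have := integral_rsing_shift 0; under eq_integral do rewrite subr0.
Qed.

Lemma integral_rsing_opp : (\int[leb]_t (rsing (- t))%:E < +oo)%E.
Proof.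
apply: (@integral_rsing_comp (fun t => - t)); first exact: measurable_funN.
move=> d d0; rewrite (_ : _ @^-1` _ = `](- d)%R, 0[%classic).
  by rewrite lebesgue_measure_itv/= lte_fin oppr_lt0 d0 -EFinB sub0r opprK.
by apply/seteqP; split => t /=; rewrite !in_itv/= => ?; lra.
Qed.

End singularity.

(** * The weighted norm *)

Section weighted_L1.
Context {R : realType}.
Local Notation leb := (@lebesgue_measure R).
Local Notation m := (@circle_measure R).

(** The weight, at least [1], whose only singularity is a blow-up as the
    argument decreases to [0]. *)
Definition weight (z : circle R) : R := 1 + rsing (carg z).

(** The norm of [L^1] with respect to the measure of density [weight]. *)
Definition wnorm (f : circle R -> \bar R) : \bar R :=
  (\int[m]_z (f z * (weight z)%:E))%E.

Lemma weight_ge1 z : 1 <= weight z.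
Proof. by rewrite lerDl rsing_ge0. Qed.

Lemma weight_gt0 z : 0 < weight z.
Proof. exact: lt_le_trans (weight_ge1 z). Qed.

Lemma weight_ge0 z : (0 <= (weight z)%:E)%E.
Proof. by rewrite lee_fin ltW// weight_gt0. Qed.

Lemma measurable_weight : measurable_fun [set: circle R] weight.
Proof.
apply: measurable_funD => //.
by apply: measurableT_comp; [exact: measurable_rsing|exact: measurable_carg].
Qed.

Lemma measurable_mul_weight f : measurable_fun [set: circle R] f ->
  measurable_fun [set: circle R] (fun z => (f z * (weight z)%:E)%E).
Proof.
move=> mf; apply: emeasurable_funM => //.
by apply/measurable_EFinP; exact: measurable_weight.
Qed.

Lemma integral_weight : (\int[m]_z (weight z)%:E < +oo)%E.
Proof.
rewrite ge0_integral_circle;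
    [|by apply/measurable_EFinP; exact: measurable_weight|exact: weight_ge0].
apply: lte_mul_pinfty; rewrite ?lee_fin ?invr_2pi_ge0//.
have mr D : measurable_fun D (EFin \o @rsing R).
  by apply/measurable_EFinP; apply: measurable_funTS; exact: measurable_rsing.
have r0 t : (0 <= (EFin \o @rsing R) t)%E by rewrite lee_fin rsing_ge0.
have -> : (\int[leb]_(t in `[(- pi)%R, pi[) (weight (expi t))%:E =
    \int[leb]_(t in `[(- pi)%R, pi[) (1%:E + (rsing t)%:E))%E.
  apply: eq_integral => t; rewrite inE/= in_itv/= => tpi.
  by rewrite /weight carg_expi.
rewrite ge0_integralD//; [|by move=> t _; exact: r0|exact: mr].
rewrite lte_add_pinfty//.
  rewrite integral_cst//= mul1e lebesgue_measure_itv/=.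
  by case: ifP => _; rewrite ?ltry// -EFinB ltry.
apply: le_lt_trans integral_rsing.
by apply: ge0_subset_integral => //; [exact: mr|move=> t _; exact: r0].
Qed.

Lemma le_wnorm f : L0plus f -> (\int[m]_z f z <= wnorm f)%E.
Proof.
move=> [mf f0]; apply: ge0_le_integral => //.
- exact: measurable_mul_weight.
- by move=> z _; rewrite lee_pemulr// lee_fin weight_ge1.
Qed.

Lemma wnorm_banach : banach_function_norm wnorm.
Proof.
have pos f : L0plus f -> forall z, (0 <= f z * (weight z)%:E)%E.
  by move=> [mf f0] z; rewrite mule_ge0// weight_ge0.
have meas f : L0plus f ->
    measurable_fun [set: circle R] (fun z => (f z * (weight z)%:E)%E).
  by move=> [mf f0]; exact: measurable_mul_weight.
split.
- by move=> f hf; apply: integral_ge0 => z _; exact: pos.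
- move=> f hf.
  have -> : wnorm f = (\int[m]_z `|f z * (weight z)%:E|)%E.
    by apply: eq_integral => z _; rewrite gee0_abs// pos.
  rewrite (ae_eq_integral_abs m measurableT (meas f hf)); split; apply: filterS => z /=.
    move=> /(_ I)/eqP; rewrite mule_eq0 eqe (gt_eqF (weight_gt0 z)) orbF.
    by move/eqP.
  by move=> -> _; rewrite mul0e.
- move=> a f a0 hf; rewrite /wnorm -ge0_integralZl//; [|exact: meas|by move=> z _; exact: pos].
  by apply: eq_integral => z _; rewrite muleA.
- move=> f g hf hg; rewrite /wnorm -ge0_integralD//;
    [|by move=> z _; exact: pos|exact: meas|by move=> z _; exact: pos|exact: meas].
  rewrite le_eqVlt; apply/orP; left; apply/eqP; apply: eq_integral => z _.
  by rewrite ge0_muleDl//; [exact: hf.2|exact: hg.2].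
- move=> f g hf hg gf; apply: ae_ge0_le_integral => //;
    [by move=> z _; exact: pos|exact: meas|by move=> z _; exact: pos|exact: meas|].
  by apply: filterS gf => z gfz _; rewrite lee_wpmul2r// weight_ge0.
(* outside a null set [N] the convergence is monotone at every point *)
- move=> f_ f hf_ hf [N [mN N0 subN]].
  have mNC : measurable (~` N) by exact: measurableC.
  have good z : (~` N) z -> nondecreasing_seq (f_ ^~ z) /\ f_ ^~ z @ \oo --> f z.
    by move=> Nz; apply: contrapT => h; apply: Nz; apply: subN.
  have red g : L0plus g -> wnorm g = (\int[m]_(z in ~` N) (g z * (weight z)%:E))%E.
    move=> hg; rewrite /wnorm (ge0_negligible_integral mN)//;
        [|exact: meas|by move=> z _; exact: pos].
    by rewrite setTD.
  have E : wnorm \o f_ = fun n => (\int[m]_(z in ~` N) (f_ n z * (weight z)%:E))%E.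
    by apply/funext => n; rewrite /= red.
  have nd z : (~` N) z -> nondecreasing_seq (fun n => f_ n z * (weight z)%:E)%E.
    by move=> /good[ndz _] a b ab; rewrite lee_wpmul2r ?weight_ge0// ndz.
  have measN g : L0plus g -> measurable_fun (~` N) (fun z => (g z * (weight z)%:E)%E).
    by move=> /meas; exact: measurable_funTS.
  rewrite E; split.
    move=> a b ab; apply: ge0_le_integral => //;
        [by move=> z _; exact: pos|exact: measN|exact: measN|].
    by move=> z Nz; exact: nd.
  rewrite red// (_ : (\int[m]_(z in ~` N) _)%E =
      (\int[m]_(z in ~` N) limn (fun n => f_ n z * (weight z)%:E))%E); last first.
    apply: eq_integral => z; rewrite inE => /good[_ cz]; apply/esym/cvg_lim => //.
    exact: cvgeZr.
  by apply: cvg_monotone_convergence => //; [move=> n; exact: measN|move=> n z _; exact: pos].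
- move=> E mE _; apply: le_lt_trans integral_weight; apply: ge0_le_integral => //.
  + by move=> z _; rewrite mule_ge0 ?weight_ge0// lee_fin.
  + by apply: measurable_mul_weight; apply/measurable_EFinP; exact: measurable_indic.
  + by apply/measurable_EFinP; exact: measurable_weight.
  + by move=> z _; rewrite -EFinM lee_fin ler_piMl ?(ltW (weight_gt0 _))// indicE lern1 leq_b1.
- move=> E mE; exists 1 => // f hf; rewrite mul1e.
  apply: le_trans (le_wnorm f hf); case: hf => mf f0.
  by apply: ge0_subset_integral.
Qed.

End weighted_L1.

(** * Approximation by rational step functions *)

Section step_approximation.
Context {R : realType}.
Local Notation leb := (@lebesgue_measure R).
Local Notation m := (@circle_measure R).

Lemma continuous_segment_uniform (g : R -> R) (a b e : R) :
  continuous g -> 0 < e -> exists2 d, 0 < d &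
    forall x y, a <= x <= b -> `|y - x| < d -> `|g y - g x| < e.
Proof.
move=> cg e0.
have /compact_near_coveringP cK := @segment_compact R a b.
have [] := cK R (0^'+) (fun d x => forall y, `|y - x| < d -> `|g y - g x| < e) _.
  move=> x _; have /cvgrPdist_lt /(_ (e / 2)) := cg x.
  rewrite divr_gt0// => /(_ isT) /nbhs_ballP [r /= r0 hr].
  exists (ball x (r / 2), [set d | 0 < d < r / 2]) => /=.
    split; first by apply: nbhsx_ballx; rewrite divr_gt0.
    near=> d; apply/andP; split; near: d; first exact: nbhs_right_gt.
    by apply: nbhs_right_lt; rewrite divr_gt0.
  move=> [x' d]/= [xx' /andP[d0 dr]] y yx'.
  rewrite /ball/= in xx'.
  have h1 : `|g x - g x'| < e / 2 by apply: hr; rewrite /ball/=; lra.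
  have h2 : `|g x - g y| < e / 2.
    apply: hr; rewrite /ball/= (_ : x - y = (x - x') - (y - x')); last by ring.
    by apply: le_lt_trans (ler_normB _ _) _; lra.
  rewrite (_ : g y - g x' = (g x - g x') - (g x - g y)); last by ring.
  by apply: le_lt_trans (ler_normB _ _) _; lra.
move=> r /= r0 hr; exists (r / 2); first by rewrite divr_gt0.
move=> x y xab; apply: (hr (r / 2)) => //=.
  by rewrite sub0r normrN gtr0_norm ?divr_gt0//; lra.
by rewrite divr_gt0.
Unshelve. all: by end_near. Qed.

(** The step function on [-pi, pi[ that takes the successive values of [s] on
    successive intervals of length [1/N], and [0] once [s] is exhausted. *)
Definition stepf (s : seq rat) (N : nat) (t : R) : R :=
  ratr (nth 0 s (Num.truncn ((t + pi) * N%:R))).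

Lemma measurable_stepf s N : measurable_fun [set: R] (stepf s N).
Proof.
have mtrunc k : measurable [set t : R | Num.truncn ((t + pi) * N%:R) = k].
  have mf : measurable_fun [set: R]
      (fun t : R => (Num.truncn ((t + pi) * N%:R))%:R : R).
    apply: nondecreasing_measurable => // x y xy.
    by rewrite ler_nat le_truncn// ler_wpM2r// lerD2r.
  have := mf measurableT _ (measurable_set1 (k%:R : R)); rewrite setTI.
  congr measurable; apply/seteqP; split => t /=; last by move=> ->.
  by move/eqP; rewrite eqr_nat => /eqP.
move=> _ A mA; rewrite setTI.
rewrite (_ : _ @^-1` A =
    \bigcup_(k in [set k | A (ratr (nth 0 s k))])
      [set t : R | Num.truncn ((t + pi) * N%:R) = k]).
  by apply: bigcup_measurable => k _; exact: mtrunc.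
apply/seteqP; split => t /=; first by move=> At; eexists; [exact: At|].
by move=> [k /= Ak] h; rewrite /stepf h.
Qed.

Lemma stepf_bounded s N : exists2 M, 0 <= M & forall t, `|stepf s N t| <= M.
Proof.
exists (\sum_(q <- s) `|ratr q|); first exact: sumr_ge0.
move=> t; rewrite /stepf; set k := Num.truncn _.
have [ks|ks] := ltnP k (size s).
  by rewrite (big_nth 0) big_mkord (bigD1 (Ordinal ks))//= lerDl sumr_ge0.
by rewrite nth_default// rmorph0 normr0 sumr_ge0.
Qed.

Lemma continuous_stepf_approx (g : R -> R) (e : R) : continuous g -> 0 < e ->
  exists s N, forall t, - pi <= t < pi -> `|g t - stepf s N t| < e.
Proof.
move=> cg e0; have e2 : 0 < e / 2 by rewrite divr_gt0.
have [d d0 gd] := continuous_segment_uniform _ (- pi) pi _ cg e2.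
pose N := (Num.truncn d^-1).+1.
have N0 : 0 < N%:R :> R by rewrite ltr0n.
have Nd : N%:R^-1 < d.
  by rewrite -[ltRHS]invrK ltf_pV2 ?posrE ?invr_gt0// truncnS_gt.
have rat_near (x : R) : exists q : rat, `|x - ratr q| < e / 2.
  have [q] := @rat_in_itvoo R (x - e / 2) (x + e / 2) ltac:(lra).
  by rewrite in_itv/= => qx; exists q; rewrite ltr_norml; lra.
pose q (k : nat) : rat := projT1 (cid (rat_near (g (k%:R / N%:R - pi)))).
have qP k : `|g (k%:R / N%:R - pi) - ratr (q k)| < e / 2.
  exact: projT2 (cid (rat_near _)).
pose K := (Num.truncn (2 * pi * N%:R : R)).+1.
exists (mkseq q K), N => t /andP[pit tpi].
rewrite /stepf; set k := Num.truncn _.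
have t0 : 0 <= (t + pi) * N%:R by rewrite mulr_ge0//; lra.
have kK : (k < K)%N.
  by rewrite ltnS le_truncn// ler_wpM2r//; lra.
rewrite nth_mkseq//.
have /andP[k1 k2] := truncn_itv t0; rewrite -/k in k1 k2.
have tk : `|k%:R / N%:R - pi - t| < d.
  apply: le_lt_trans Nd; rewrite ler_norml.
  have h1 : k%:R / N%:R <= t + pi by rewrite ler_pdivrMr.
  have h2 : t + pi <= k%:R / N%:R + N%:R^-1.
    by rewrite -[X in _ <= _ + X]mul1r -mulrDl natr1 ler_pdivlMr// ltW.
  have h3 : 0 < N%:R^-1 :> R by rewrite invr_gt0.
  by apply/andP; split; lra.
have h1 := gd t _ ltac:(lra) tk; have h2 := qP k.
rewrite (_ : g t - _ = (g (k%:R / N%:R - pi) - ratr (q k)) -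
   (g (k%:R / N%:R - pi) - g t)); last by ring.
by apply: le_lt_trans (ler_normB _ _) _; lra.
Qed.

(** Density of the countable family of rational step functions in [L^1]. *)
Lemma integrable_stepf_approx (F : R -> R) (e : R) :
  leb.-integrable `[(- pi)%R, pi[ (EFin \o F) -> 0 < e ->
  exists s N, (\int[leb]_(t in `[(- pi)%R, pi[) `|F t - stepf s N t|%:E < e%:E)%E.
Proof.
move=> iF e0.
have p0 := @pi_gt0 R.
have len : leb `[(- pi)%R, pi[ = (2 * pi)%:E.
  rewrite lebesgue_measure_itv/= lte_fin gtrN// -EFinB; congr _%:E; ring.
have lenoo : (leb `[(- pi)%R, pi[ < +oo)%E by rewrite len ltry.
have [g_ [cg ig cvg0]] := approximation_continuous_integrable (measurable_itv _) lenoo iF.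
have e2 : 0 < e / 2 by rewrite divr_gt0.
have [n gn] : exists n,
    (\int[leb]_(t in `[(- pi)%R, pi[) `|(F t - g_ n t)%:E| < (e / 2)%:E)%E.
  have : \forall n \near \oo,
      (\int[leb]_(t in `[(- pi)%R, pi[) `|(F t - g_ n t)%:E| < (e / 2)%:E)%E.
    apply: (cvg0 [set x | (x < (e / 2)%:E)%E]); apply: open_nbhs_nbhs.
    by split; [exact: open_ereal_lt_ereal|rewrite /= lte_fin].
  by move=> [n _ hn]; exists n; exact: hn (leqnn n).
have e4 : 0 < e / 2 / (2 * pi) by rewrite divr_gt0// mulr_gt0.
have [s [N sN]] := continuous_stepf_approx _ _ (cg n) e4.
have mF : measurable_fun `[(- pi)%R, pi[ F.
  by apply/measurable_EFinP; case/integrableP: iF.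
have mg D : measurable_fun D (g_ n).
  by apply: measurable_funTS; exact: continuous_measurable_fun.
have ms D : measurable_fun D (stepf s N).
  by apply: measurable_funTS; exact: measurable_stepf.
have mFs : measurable_fun `[(- pi)%R, pi[
    (fun t : R => `|F t - stepf s N t|%:E).
  apply/measurable_EFinP; apply: measurableT_comp => //.
  exact: measurable_funB.
have mFg : measurable_fun `[(- pi)%R, pi[ (fun t : R => `|(F t - g_ n t)%:E|)%E.
  apply: measurableT_comp => //; apply/measurable_EFinP.
  exact: measurable_funB.
exists s, N.
apply: (@le_lt_trans _ _ (\int[leb]_(t in `[(- pi)%R, pi[)
    (`|(F t - g_ n t)%:E| + (e / 2 / (2 * pi))%:E)))%E.
  apply: ge0_le_integral => //.
    by apply: emeasurable_funD => //; exact: mFg.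
  move=> t; rewrite /= in_itv/= => tpi; rewrite -EFinD lee_fin.
  rewrite (_ : F t - stepf s N t = (F t - g_ n t) + (g_ n t - stepf s N t)).
    by rewrite (le_trans (ler_normD _ _))// lerD2l ltW// sN.
  by ring.
rewrite ge0_integralD//; last by move=> t _; rewrite lee_fin ltW.
rewrite integral_cst//= [X in (_ * X)%E]len -EFinM divfK.
  rewrite [e in ltRHS](_ : e = e / 2 + e / 2); last by field.
  by rewrite EFinD lte_leD.
by rewrite gt_eqF// mulr_gt0.
Qed.

End step_approximation.

(** * Separability *)

Section weighted_separability.
Context {R : realType}.
Local Notation leb := (@lebesgue_measure R).
Local Notation m := (@circle_measure R).

Lemma ge_normc_Re (z : R[i]) : `|complex.Re z| <= Normc.normc z.
Proof.
by case: z => a b /=; rewrite -sqrtr_sqr ler_wsqrtr// lerDl sqr_ge0.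
Qed.

Lemma ge_normc_Im (z : R[i]) : `|complex.Im z| <= Normc.normc z.
Proof.
by case: z => a b /=; rewrite -sqrtr_sqr ler_wsqrtr// lerDr sqr_ge0.
Qed.

Lemma normc_ge0 (z : R[i]) : 0 <= Normc.normc z.
Proof. by apply: le_trans (ge_normc_Re z). Qed.

Lemma normc_le_ReIm (z : R[i]) :
  Normc.normc z <= `|complex.Re z| + `|complex.Im z|.
Proof.
case: z => a b /=.
rewrite -[leRHS]ger0_norm ?addr_ge0// -sqrtr_sqr ler_wsqrtr// sqrrD !real_normK ?num_real//.
by rewrite addrAC lerDl mulrn_wge0// mulr_ge0.
Qed.

Lemma measurable_emod (f : circle R -> R[i]) : cmeasurable f ->
  measurable_fun [set: circle R] (emod f).
Proof.
move=> [mRe mIm]; apply/measurable_EFinP.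
rewrite (_ : (fun z => _) =
    (fun z => Num.sqrt ((complex.Re (f z)) ^+ 2 + (complex.Im (f z)) ^+ 2))).
  apply: measurableT_comp; last by apply: measurable_funD; exact: measurable_funX.
  by apply: continuous_measurable_fun; exact: sqrt_continuous.
by apply/funext => z; case: (f z).
Qed.

Lemma cmeasurableB (f g : circle R -> R[i]) : cmeasurable f -> cmeasurable g ->
  cmeasurable (fun z => f z - g z).
Proof.
move=> [f1 f2] [g1 g2]; split.
  rewrite (_ : (fun z => _) = fun z => complex.Re (f z) - complex.Re (g z)).
    exact: measurable_funB.
  by apply/funext => z; rewrite raddfB.
rewrite (_ : (fun z => _) = fun z => complex.Im (f z) - complex.Im (g z)).
  exact: measurable_funB.
by apply/funext => z; rewrite raddfB.
Qed.

(** Complex step functions in the argument, divided by the weight: the map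
    [f |-> f * weight] is an isometry onto the unweighted space, where step
    functions are dense. *)
Definition wstep (p : (seq rat * nat) * (seq rat * nat)) (z : circle R) : R[i] :=
  (stepf p.1.1 p.1.2 (carg z) / weight z +i*
   (stepf p.2.1 p.2.2 (carg z) / weight z))%C.

Lemma measurable_wstep_part s N :
  measurable_fun [set: circle R] (fun z => stepf s N (carg z) / weight z).
Proof.
apply: measurable_funM.
  by apply: measurableT_comp; [exact: measurable_stepf|exact: measurable_carg].
rewrite (_ : (fun z => _) = (fun x : R => x `^ (-1)) \o weight).
  apply: measurableT_comp; [exact: measurable_powR|exact: measurable_weight].
by apply/funext => z; rewrite /= powR_inv1// ltW// weight_gt0.
Qed.

Lemma bfs_wstep p : bfs wnorm (wstep p).
Proof.
have cm : cmeasurable (wstep p) by split; exact: measurable_wstep_part.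
split=> //.
have [M1 M10 hM1] := @stepf_bounded R p.1.1 p.1.2.
have [M2 M20 hM2] := @stepf_bounded R p.2.1 p.2.2.
have mw : measurable_fun [set: circle R] (EFin \o @weight R).
  by apply/measurable_EFinP; exact: measurable_weight.
have part (a M w : R) : `|a| <= M -> 0 <= M -> 1 <= w -> `|a / w| <= M.
  move=> aM M0 w1; have w0 : 0 < w by rewrite (lt_le_trans _ w1).
  by rewrite normrM [`|w^-1|]gtr0_norm ?invr_gt0// ler_pdivrMr// (le_trans aM)// ler_peMr.
apply: (@le_lt_trans _ _ (\int[m]_z ((M1 + M2)%:E * (weight z)%:E)))%E.
  apply: ge0_le_integral => //.
  - by move=> z _; rewrite mule_ge0 ?weight_ge0// lee_fin normc_ge0.
  - by apply: measurable_mul_weight; exact: measurable_emod.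
  - by apply: emeasurable_funM.
  - move=> z _; rewrite lee_wpmul2r ?weight_ge0// lee_fin.
    rewrite (le_trans (normc_le_ReIm _))//= lerD//; apply: part => //;
    exact: weight_ge1.
rewrite ge0_integralZl//; last 2 first.
- by move=> z _; exact: weight_ge0.
- by rewrite lee_fin addr_ge0.
by rewrite lte_mul_pinfty ?lee_fin ?addr_ge0// integral_weight.
Qed.

(** [part] stands for the real or the imaginary part. *)
Lemma integrable_weighted_part (f : circle R -> R[i]) (part : R[i] -> R) :
  bfs wnorm f -> measurable_fun [set: circle R] (part \o f) ->
  (forall z, `|part z| <= Normc.normc z) ->
  leb.-integrable `[(- pi)%R, pi[
    (EFin \o (fun t => part (f (expi t)) * weight (expi t))).
Proof.
move=> [cmf foo] mpf partle.
have mt (D : set R) : measurable_fun D (fun t => part (f (expi t)) * weight (expi t)).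
  apply: measurable_funTS; apply: measurable_funM.
    exact: (measurableT_comp mpf (@measurable_expi R)).
  exact: (measurableT_comp measurable_weight (@measurable_expi R)).
have mef := measurable_mul_weight _ (measurable_emod _ cmf).
apply/integrableP; split; first by apply/measurable_EFinP; exact: mt.
have : (\int[leb]_(t in `[(- pi)%R, pi[) (emod f (expi t) * (weight (expi t))%:E) < +oo)%E.
  rewrite ltNge leye_eq; apply/negP => /eqP h; move: foo; rewrite /wnorm.
  rewrite ge0_integral_circle//.
    by rewrite h gt0_muley ?ltxx// lte_fin invr_gt0 mulr_gt0 ?pi_gt0.
  by move=> z; rewrite mule_ge0 ?weight_ge0// lee_fin normc_ge0.
apply: le_lt_trans; apply: ge0_le_integral_nonmeasurable => t _; first exact: abse_ge0.
rewrite /= lee_fin normrM [`|weight _|]gtr0_norm ?weight_gt0//.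
by rewrite ler_wpM2r// ltW// weight_gt0.
Qed.

Lemma bfs_separable_wnorm : bfs_separable (@wnorm R).
Proof.
exists [set wstep p | p in [set: (seq rat * nat) * (seq rat * nat)]]; split.
- by apply: sub_countable (card_image_le _ _) _; exact: countableP.
- by move=> _ [p _ <-]; exact: bfs_wstep.
move=> f e bf e0.
have p0 := @pi_gt0 R.
have ep : 0 < e * pi by rewrite mulr_gt0.
have [s1 [N1 h1]] := integrable_stepf_approx _ _
  (integrable_weighted_part f (@complex.Re R) bf bf.1.1 ge_normc_Re) ep.
have [s2 [N2 h2]] := integrable_stepf_approx _ _
  (integrable_weighted_part f (@complex.Im R) bf bf.1.2 ge_normc_Im) ep.
exists (wstep ((s1, N1), (s2, N2))); first by exists ((s1, N1), (s2, N2)).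
have ms s N (D : set R) : measurable_fun D (@stepf R s N).
  by apply: measurable_funTS; exact: measurable_stepf.
have mpart (part : R[i] -> R) s N :
    measurable_fun [set: circle R] (part \o f) -> measurable_fun `[(- pi)%R, pi[
    (fun t : R => `|part (f (expi t)) * weight (expi t) - stepf s N t|%:E).
  move=> mp; apply/measurable_EFinP; apply: measurableT_comp => //.
  apply: measurable_funB; last exact: ms.
  apply: measurable_funTS; apply: measurable_funM.
    exact: (measurableT_comp mp (@measurable_expi R)).
  exact: (measurableT_comp measurable_weight (@measurable_expi R)).
have cmd : cmeasurable (fun z => f z - wstep ((s1, N1), (s2, N2)) z).
  by apply: cmeasurableB bf.1 _; exact: (bfs_wstep _).1.
rewrite /bfs_norm /wnorm ge0_integral_circle; last 2 first.
- by apply: measurable_mul_weight; exact: measurable_emod.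
- by move=> z; rewrite mule_ge0 ?weight_ge0// lee_fin normc_ge0.
apply: (@le_lt_trans _ _ (((2 * pi)^-1)%:E * (\int[leb]_(t in `[(- pi)%R, pi[)
  (`|complex.Re (f (expi t)) * weight (expi t) - stepf s1 N1 t|%:E +
   `|complex.Im (f (expi t)) * weight (expi t) - stepf s2 N2 t|%:E))))%E.
  rewrite lee_wpmul2l// ?lee_fin ?invr_2pi_ge0//.
  apply: ge0_le_integral_nonmeasurable => t.
    by move=> _; rewrite mule_ge0 ?weight_ge0// lee_fin normc_ge0.
  rewrite /= in_itv/= => tpi; rewrite -EFinM -EFinD lee_fin.
  have w0 := weight_gt0 (expi t).
  have quot (a b w : R) : 0 < w -> `|a * w - b| = `|a - b / w| * w.
    move=> w1; rewrite -[X in _ = _ * X](gtr0_norm w1) -normrM mulrBl divfK//.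
    by rewrite gt_eqF.
  rewrite !(quot _ _ _ w0) -mulrDl ler_wpM2r ?(ltW w0)//.
  apply: le_trans (normc_le_ReIm _) _.
  by rewrite !raddfB/= carg_expi.
rewrite ge0_integralD//; [|exact: mpart bf.1.1|exact: mpart bf.1.2].
rewrite muleC lte_pdivrMr ?mulr_gt0// -EFinM.
rewrite (_ : e * (2 * pi) = e * pi + e * pi); last by ring.
by rewrite EFinD lteD.
Qed.

End weighted_separability.

(** * Fejer means of the mirrored singularity *)

Section divergence.
Context {R : realType}.
Local Notation leb := (@lebesgue_measure R).
Local Notation m := (@circle_measure R).

(** The mirror image of the singularity of the weight: it lies in the region
    where the weight is [1]. *)
Definition fsing (z : circle R) : R[i] := ((rsing (- carg z))%:C)%C.

Lemma measurable_rsing_opp : measurable_fun [set: R] (fun t : R => rsing (- t)).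
Proof. by apply: (measurableT_comp measurable_rsing); exact: measurable_funN. Qed.

Lemma cmeasurable_fsing : cmeasurable fsing.
Proof.
split; last exact: measurable_cst.
exact: (measurableT_comp measurable_rsing_opp measurable_carg).
Qed.

(** The singularities of [fsing] and of the weight have disjoint supports. *)
Lemma rsing_mul_opp (t : R) : rsing (- t) * rsing t = 0.
Proof.
have [t0|t0] := leP t 0; last by rewrite rsing_out ?mul0r//; lra.
by rewrite [rsing t]rsing_out ?mulr0//; lra.
Qed.

Lemma bfs_fsing : bfs wnorm fsing.
Proof.
split; first exact: cmeasurable_fsing.
rewrite /wnorm ge0_integral_circle; last 2 first.
- by apply: measurable_mul_weight; apply: measurable_emod; exact: cmeasurable_fsing.
- by move=> z; rewrite mule_ge0 ?weight_ge0// lee_fin normc_ge0.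
apply: lte_mul_pinfty; rewrite ?lee_fin ?invr_2pi_ge0//.
have mr D : measurable_fun D (fun t : R => (rsing (- t))%:E).
  by apply/measurable_EFinP; apply: measurable_funTS; exact: measurable_rsing_opp.
have -> : (\int[leb]_(t in `[(- pi)%R, pi[) (emod fsing (expi t) * (weight (expi t))%:E) =
    \int[leb]_(t in `[(- pi)%R, pi[) (rsing (- t))%:E)%E.
  apply: eq_integral => t; rewrite inE/= in_itv/= => tpi.
  rewrite /emod /weight /= carg_expi// expr0n addr0 sqrtr_sqr ger0_norm ?rsing_ge0//.
  by rewrite -EFinM mulrDr mulr1 rsing_mul_opp addr0.
apply: le_lt_trans integral_rsing_opp.
by apply: ge0_subset_integral => //; [exact: mr|move=> t _; rewrite lee_fin rsing_ge0].
Qed.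

(** The integrand of the convolution of [fsing] at [e^(i x)], without arguments. *)
Lemma fsing_translate (x t : R) : 0 < x <= 1 -> - pi <= t <= pi ->
  fsing (circle_mul (expi x) (expi (- t))) = ((rsing (t - x))%:C)%C.
Proof.
move=> x01 tpi; rewrite circle_mulE /fsing; congr (_%:C)%C.
have pi2 := pi_ge2 R.
have [lt|ge] := ltP (x - t) pi.
  by rewrite carg_expi ?opprB//; lra.
(* the representative of [x - t] in [-pi, pi[ is at distance at least [1]
   from the singularity *)
have -> : expi (x - t) = expi (x - t - 2 * pi) :> circle R.
  by rewrite -[LHS](expi_periodic _ (-1)) mulN1r.
by rewrite carg_expi ?rsing_out//; lra.
Qed.

Lemma Re_convolution_fsing n (x : R) : 0 < x <= 1 ->
  complex.Re (convolution fsing (fejer n) (expi x)) = (2 * pi)^-1 *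
  (\int[leb]_(t in `[(- pi)%R, pi]) (rsing (t - x) * fejer_re n t))%R.
Proof.
move=> x01; rewrite /convolution /cintegral /= mul0r subr0; congr (_ * _).
apply: eq_Rintegral => t; rewrite inE/= in_itv/= => tpi.
by rewrite fsing_translate// /fejer_re; case: (fejer n (expi t)) => a b /=; rewrite mul0r subr0.
Qed.

(** On a window of length [d = 1/(2n)] to the right of the singularity of
    [fsing], the mean with respect to the Fejer kernel is of order [d^(-1/2)]. *)
Lemma Re_convolution_fsing_ge n (d x : R) : (0 < n)%N -> d = (2 * n%:R)^-1 ->
  0 < x < d ->
  (2 * pi)^-1 * ((Num.sqrt d)^-1 * (n.+1%:R * cos 1 ^+ 2) * d) <=
  complex.Re (convolution fsing (fejer n) (expi x)).
Proof.
move=> n0 dn /andP[x0 xd].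
have nR : 1 <= n%:R :> R by rewrite ler1n.
have d0 : 0 < d by rewrite dn invr_gt0 mulr_gt0// (lt_le_trans _ nR).
have nd : n%:R * (2 * d) = 1 by rewrite dn; field; rewrite pnatr_eq0 -lt0n.
have d2 : 2 * d <= 1 by rewrite -[leRHS]nd ler_peMl// mulr_ge0// ltW.
have pi2 := pi_ge2 R.
rewrite Re_convolution_fsing; last by lra.
rewrite ler_wpM2l ?invr_2pi_ge0// /Rintegral.
set K := (Num.sqrt d)^-1 * _.
have K0 : 0 <= K.
  by rewrite mulr_ge0 ?invr_ge0 ?sqrtr_ge0// mulr_ge0// exprn_ge0// ltW// cos1_gt0.
have mr : measurable_fun [set: R] (fun t : R => rsing (t - x)).
  by apply: (measurableT_comp measurable_rsing); exact: measurable_funB.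
have mf D : measurable_fun D (fun t : R => (rsing (t - x) * fejer_re n t)%:E).
  apply: measurable_funTS; apply/measurable_EFinP; apply: measurable_funM => //.
  exact: measurable_fejer_re.
(* [Rintegral] is the finite part of the integral, so a lower bound for it
   requires the integral to be finite *)
have fin : (\int[leb]_(t in `[(- pi)%R, pi]) (rsing (t - x) * fejer_re n t)%:E < +oo)%E.
  apply: (@le_lt_trans _ _ (\int[leb]_t ((2 * n.+1%:R)%:E * (rsing (t - x))%:E)))%E.
    apply: (@le_trans _ _ (\int[leb]_t (rsing (t - x) * fejer_re n t)%:E))%E.
      apply: ge0_subset_integral => //; first exact: mf.
      by move=> t _; rewrite lee_fin mulr_ge0 ?rsing_ge0 ?fejer_re_ge0.
    apply: ge0_le_integral_nonmeasurable => t _.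
      by rewrite lee_fin mulr_ge0 ?rsing_ge0 ?fejer_re_ge0.
    by rewrite -EFinM lee_fin mulrC ler_wpM2r ?rsing_ge0 ?fejer_re_le.
  rewrite ge0_integralZl//.
  - by rewrite lte_mul_pinfty ?lee_fin ?mulr_ge0// integral_rsing_shift.
  - by apply/measurable_EFinP; exact: mr.
  - by move=> t _; rewrite lee_fin rsing_ge0.
pose A := `]x, (x + d)%R[%classic : set R.
have low : ((K * d)%:E <=
    \int[leb]_(t in `[(- pi)%R, pi]) (rsing (t - x) * fejer_re n t)%:E)%E.
  have -> : (K * d)%:E = (\int[leb]_(t in `[(- pi)%R, pi]) (K%:E * (\1_A t)%:E))%E.
    have mA : measurable_fun `[(- pi)%R, pi] (fun t : R => (\1_A t)%:E : \bar R).
      by apply/measurable_EFinP; apply: measurable_indic; exact: measurable_itv.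
    rewrite ge0_integralZl// integral_indic//; last exact: measurable_itv.
    rewrite setIidl; last by move=> t; rewrite /A /= !in_itv/=; lra.
    rewrite EFinM; congr (_ * _)%E.
    by rewrite /= lebesgue_measure_itv/= lte_fin ltrDl d0 -EFinB addrAC subrr add0r.
  apply: ge0_le_integral_nonmeasurable => t _; first by rewrite -EFinM lee_fin mulr_ge0.
  rewrite -EFinM lee_fin indicE; have [|_] := boolP (t \in A); last first.
    by rewrite mulr0 mulr_ge0 ?rsing_ge0 ?fejer_re_ge0.
  rewrite inE /A /= in_itv/= mulr1 => tA.
  rewrite ler_pM ?invr_ge0 ?sqrtr_ge0//.
  - by rewrite mulr_ge0// exprn_ge0// ltW// cos1_gt0.
  - by apply: rsing_ge; lra.
  - apply: fejer_re_ge; rewrite -[leRHS]nd ler_wpM2l// gtr0_norm; lra.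
rewrite -lee_fin fineK// ge0_fin_numE//.
by apply: le_trans low; rewrite lee_fin mulr_ge0// ltW.
Qed.

(** The bound does not depend on [n]: with [d = 1/(2n)], the product of the lower
    bounds for the convolution and the weight and of the measure of the arc is
    [(2 pi)^-2 (cos 1)^2 (n + 1) d], and [(n + 1) d >= 1/2]. *)
Lemma bfs_norm_fejer_fsing_ge n : (0 < n)%N ->
  (((2 * pi)^-1 ^+ 2 * cos 1 ^+ 2 / 2)%:E <=
   bfs_norm wnorm (fun z => convolution fsing (fejer n) z - fsing z)%R)%E.
Proof.
move=> n0; pose d : R := (2 * n%:R)^-1.
have nR : 1 <= n%:R :> R by rewrite ler1n.
have d0 : 0 < d by rewrite /d invr_gt0 mulr_gt0// (lt_le_trans _ nR).
have nd : n%:R * (2 * d) = 1 by rewrite /d; field; rewrite pnatr_eq0 -lt0n.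
have d2 : 2 * d <= 1 by rewrite -[leRHS]nd ler_peMl// mulr_ge0// ltW.
have pi2 := pi_ge2 R.
set C := _ / 2.
pose K := (2 * pi)^-1 * ((Num.sqrt d)^-1 * (n.+1%:R * cos 1 ^+ 2) * d).
have K0 : 0 <= K.
  rewrite /K mulr_ge0 ?invr_2pi_ge0// mulr_ge0 ?(ltW d0)// mulr_ge0 ?invr_ge0 ?sqrtr_ge0//.
  by rewrite mulr_ge0// exprn_ge0// ltW// cos1_gt0.
have s0 : 0 <= (Num.sqrt d)^-1 by rewrite invr_ge0 sqrtr_ge0.
(* the arc where [fsing] vanishes and both lower bounds are available *)
pose A := carg @^-1` `]0, d[%classic : set (circle R).
have mA : measurable A by rewrite -[A]setTI; exact: measurable_carg.
apply: (@le_trans _ _ (\int[m]_z ((K / Num.sqrt d)%:E * (\1_A z)%:E)))%E.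
  have mI : measurable_fun [set: circle R] (fun z => (\1_A z)%:E : \bar R).
    by apply/measurable_EFinP; exact: measurable_indic.
  have Ks0 : 0 <= K / Num.sqrt d by exact: mulr_ge0.
  rewrite ge0_integralZl// ge0_integral_circle//.
  have -> : (\int[leb]_(t in `[(- pi)%R, pi[) (\1_A (expi t))%:E = d%:E)%E.
    transitivity (\int[leb]_(t in `[(- pi)%R, pi[) (\1_(`]0%R, d[%classic : set R) t)%:E)%E.
      apply: eq_integral => t; rewrite inE/= in_itv/= => tpi.
      by rewrite !indicE /A /in_mem/= /mem/= /in_set/= carg_expi.
    rewrite integral_indic// setIidl; last by move=> t; rewrite /= !in_itv/=; lra.
    by rewrite /= lebesgue_measure_itv/= lte_fin d0 sube0.
  rewrite -!EFinM lee_fin /K /C.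
  have sd : (Num.sqrt d)^-1 * (Num.sqrt d)^-1 = d^-1.
    by rewrite -invfM -expr2 sqr_sqrtr// ltW.
  rewrite [leRHS](_ : _ = (2 * pi)^-1 ^+ 2 * cos 1 ^+ 2 * (n.+1%:R * d)).
    have nd1 : 2^-1 <= n.+1%:R * d by rewrite -[n.+1%:R]natr1; lra.
    by apply: ler_wpM2l => //; rewrite mulr_ge0// sqr_ge0.
  rewrite [LHS](_ : _ = (2 * pi)^-1 ^+ 2 * cos 1 ^+ 2 *
     (n.+1%:R * d) * (d * ((Num.sqrt d)^-1 * (Num.sqrt d)^-1))); last by ring.
  by rewrite sd mulfV ?mulr1// gt_eqF.
rewrite /bfs_norm /wnorm; apply: ge0_le_integral_nonmeasurable => z _.
  by rewrite -EFinM lee_fin mulr_ge0// mulr_ge0.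
rewrite -!EFinM lee_fin indicE; have [|_] := boolP (z \in A); last first.
  by rewrite mulr0 mulr_ge0 ?normc_ge0// ltW// weight_gt0.
move=> zin; rewrite mulr1.
have zA : 0 < carg z < d by move: zin; rewrite inE /A /= in_itv.
have /andP[z0 zd] := zA; rewrite ler_pM//.
  apply: le_trans (ge_normc_Re _); apply: le_trans (ler_norm _).
  rewrite raddfB/= rsing_out ?subr0; last by lra.
  rewrite -(expi_carg z) ?gt_eqF//; exact: Re_convolution_fsing_ge.
rewrite /weight ler_wpDl// rsing_ge//; lra.
Qed.

Lemma not_cvg_fejer_fsing :
  ~ ((fun n : nat => bfs_norm wnorm
       (fun z => convolution fsing (fejer n) z - fsing z)) @ \oo --> 0%E).
Proof.
move=> cv; set c := ((2 * pi)^-1 ^+ 2 * cos 1 ^+ 2 / 2 : R).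
have c0 : 0 < c.
  by rewrite divr_gt0// mulr_gt0 ?exprn_gt0 ?cos1_gt0// invr_gt0 mulr_gt0// pi_gt0.
have /cv [N _ hN] : nbhs (0%E : \bar R) [set y | (y < c%:E)%E].
  by apply: open_nbhs_nbhs; split; [exact: open_ereal_lt_ereal|rewrite /= lte_fin].
have := hN N.+1 (leqnSn N); rewrite /= ltNge; apply/negP; rewrite negbK.
exact: bfs_norm_fejer_fsing_ge.
Qed.

End divergence.

Theorem theorem1p3 (R : realType) :
  exists rho : (circle R -> \bar R) -> \bar R,
    [/\ banach_function_norm rho,
        bfs_separable rho &
        exists2 f : circle R -> R[i], bfs rho f &
          ~ ((fun n : nat =>
                bfs_norm rho (fun z => convolution f (fejer n) z - f z))
             @ \oo --> 0%E)].
Proof.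
exists (@wnorm R); split; [exact: wnorm_banach|exact: bfs_separable_wnorm|].
exists (@fsing R); [exact: bfs_fsing|exact: not_cvg_fejer_fsing].
Qed.
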